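(* For every $\delta\in(0,1/2)$ there exists a constant $C_\delta>0$ (depending only on $\delta$) such that for all $n\geq1$ and all trade-off functions $f_0\succeq f_1$: if for some $\alpha\in[0,1]$, $$f_0(\alpha)-f_1(\alpha)<C_\delta\,\Delta_{f_0}(\alpha;1/n),$$ then $$\inf_{\psi}\Bigl\{\mathrm{Err}_{\mathrm I}(\mathcal M_{\mathcal S_{\mathrm{MLR}}};\psi)+\mathrm{Err}_{\mathrm{II}}(\mathcal M_{\mathcal S_{\mathrm{MLR}}};\psi)\Bigr\}\geq 2\delta,$$ where the infimum is over all tests $\psi=\psi(X_{1:n},Y_{1:n})$.
   Context: Trade-off functions: for probability distributions $P,Q$ on $\mathbb R$, $T(P,Q)(\alpha)=\inf\{E_Q[1-\varphi]:\ \varphi:\mathbb R\to[0,1]\text{ measurable},\ E_P[\varphi]\leq\alpha\}$, $\alpha\in[0,1]$. A trade-off function is a convex, continuous, non-increasing $f:[0,1]\to[0,1]$ with $f(\alpha)\leq1-\alpha$; it is extended by $f(\alpha)=0$ for $\alpha>1$. $f\succeq g$ means $f(\alpha)\geq g(\alpha)$ for all $\alpha\in[0,1]$; $f\not\succeq g$ means $f(\alpha_0)<g(\alpha_0)$ for some $\alpha_0\in[0,1]$. Testing: $X_{1:n}\sim P^n$ and $Y_{1:n}\sim Q^n$ independent; for a test $\psi$ (measurable, $[0,1]$-valued function of the data), $(P^n\times Q^n)(\psi)$ is its expectation, and for a set $\mathcal M$ of pairs, $\mathrm{Err}_{\mathrm I}(\mathcal M;\psi)=\sup_{(P,Q)\in\mathcal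 M:\,T(P,Q)\succeq f_0}(P^n\times Q^n)(\psi)$, $\mathrm{Err}_{\mathrm{II}}(\mathcal M;\psi)=\sup_{(P,Q)\in\mathcal M:\,T(P,Q)\not\succeq f_1}(P^n\times Q^n)(1-\psi)$. $\mathcal S_{\mathrm{MLR}}=\{(-\infty,a),(a,+\infty):a\in\mathbb R\cup\{\pm\infty\}\}$. A pair $(P,Q)$ is $\mathcal S$-attainable if, with $\mu=(P+Q)/2$, $p=dP/d\mu$, $q=dQ/d\mu$, for every $\lambda\in[0,\infty]$ there is $S\in\mathcal S$ with $\mathbf 1_S=\mathbf 1_{\{q>\lambda p\}}$ $\mu$-a.e. (for $\lambda=\infty$, $\{q>\lambda p\}$ means $\{p=0\}$); $\mathcal M_{\mathcal S}$ is the set of all $\mathcal S$-attainable pairs. Local modulus: with $V(t)=\min\{t,(1-t)_+\}$, for a trade-off function $f$ and $r\geq0$, $\Delta_f(\alpha;r)=f(\alpha)-f(\alpha+r+\sqrt{rV(\alpha)})+\bigl(\sqrt{r\,V(f(\alpha))}\bigr)\wedge f(\alpha)$. *)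

(* Defs.v *)
From HB Require Import structures.
From mathcomp Require Import all_boot all_order all_algebra.
From mathcomp Require Import all_classical all_reals all_analysis.

Set Implicit Arguments.
Unset Strict Implicit.
Unset Printing Implicit Defensive.

Import Order.TTheory GRing.Theory Num.Theory.
Import numFieldNormedType.Exports.

Local Open Scope classical_set_scope.
Local Open Scope ring_scope.

Section iid.
Context d (T : measurableType d) (R : realType).

Definition tuple_cons n (z : T * n.-tuple T) : n.+1.-tuple T :=
  [tuple of z.1 :: z.2].

Let measurable_tuple_cons n : measurable_fun [set: _] (@tuple_cons n).
Proof. exact: measurable_cons. Qed.

HB.instance Definition _ n :=
  isMeasurableFun.Build _ _ _ _ (@tuple_cons n) (@measurable_tuple_cons n).

(* The n-fold product measure; `iid_box` below is its characterization. *)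
Fixpoint iid (P : probability T R) (n : nat) : probability (n.-tuple T) R :=
  if n is m.+1 then distribution (P \x iid P m)%E (@tuple_cons m)
  else \d_([tuple] : 0.-tuple T).

Lemma measurable_box n (A : 'I_n -> set T) :
  (forall i, measurable (A i)) ->
  measurable [set t : n.-tuple T | forall i, A i (tnth t i)].
Proof.
move=> mA; rewrite (_ : mkset _ =
    \bigcap_(i in [set: 'I_n]) ((fun t => tnth t i) @^-1` A i)).
  apply: fin_bigcap_measurable => [|i _]; first exact: finite_finset.
  by rewrite -[X in measurable X]setTI; exact: (measurable_tnth i measurableT (mA i)).
by apply/seteqP; split=> [t At i _|t At i]; [exact: At|exact: (At i I)].
Qed.

Lemma iid_box (P : probability T R) n (A : 'I_n -> set T) :
  (forall i, measurable (A i)) ->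
  iid P n [set t | forall i, A i (tnth t i)] = (\prod_(i < n) P (A i))%E.
Proof.
elim: n A => [|n IHn] A mA.
  by rewrite big_ord0/= diracE mem_set//= => -[].
rewrite big_ord_recl -IHn//= -product_measure1E//; last first.
  by apply: (@measurable_box _ (fun i => A (lift ord0 i))) => i; exact: mA.
congr (_ _); apply/seteqP; split=> -[x t]/= => [At|[Ax At] i].
  split=> [|i]; first by have := At ord0; rewrite tnth0.
  by have := At (lift ord0 i); rewrite tnthS.
by case: (unliftP ord0 i) => [j ->|->]; rewrite ?tnthS ?tnth0.
Qed.

End iid.

Section average.
Context d (T : measurableType d) (R : realType) (P Q : probability T R).

Definition average : set T -> \bar R := mscale 2^-1%:nng (measure_add P Q).

Lemma averageE A : average A = ((2^-1)%:E * (P A + Q A))%E.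
Proof. by rewrite -measure_addE. Qed.

HB.instance Definition _ := Measure.on average.

Let average_fin : fin_num_fun average.
Proof.
move=> A mA; rewrite averageE fin_numM// fin_numD.
by rewrite !fin_num_measure.
Qed.

HB.instance Definition _ := @Measure_isFinite.Build _ T R average average_fin.

Lemma average_eq0 A : average A = 0%E -> P A = 0%E /\ Q A = 0%E.
Proof.
rewrite averageE => /eqP; rewrite mule_eq0 eqe gt_eqF ?invr_gt0//=.
by rewrite padde_eq0// => /andP[/eqP-> /eqP->].
Qed.

(* Without domination, the library's Radon-Nikodym derivative is a junk value. *)
Lemma dominates_averagel : charge_of_finite_measure P `<< average.
Proof. by apply/null_content_dominatesP => A _ /average_eq0[]. Qed.

Lemma dominates_averager : charge_of_finite_measure Q `<< average.
Proof. by apply/null_content_dominatesP => A _ /average_eq0[]. Qed.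

End average.

Section testing.
Context (R : realType).
Implicit Types (f g : R -> R) (alpha t r : R).

Local Notation TR := (measurableTypeR R).

Definition is_test d (T : measurableType d) (psi : T -> R) : Prop :=
  measurable_fun [set: T] psi /\ forall x, 0 <= psi x <= 1.

Definition tradeoff (P Q : probability TR R) alpha : R :=
  inf [set (\int[Q]_x (1 - phi x))%R |
       phi in [set phi : TR -> R | is_test phi /\ \int[P]_x phi x <= alpha]].

(* Values at negative reals are irrelevant and left unconstrained. *)
Definition is_tradeoff f : Prop :=
  [/\ forall alpha, 0 <= alpha <= 1 ->
        [/\ 0 <= f alpha, f alpha <= 1 & f alpha <= 1 - alpha],
      convex_function (`[0, 1]%classic : set R^o) f,
      {within `[0, 1], continuous f},
      {in `[0, 1] &, {homo f : x y /~ x <= y}} &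
      forall alpha, 1 < alpha -> f alpha = 0].

Definition tradeoff_ge f g : Prop :=
  forall alpha, 0 <= alpha <= 1 -> g alpha <= f alpha.

Definition tradeoff_nge f g : Prop :=
  exists2 alpha, 0 <= alpha <= 1 & f alpha < g alpha.

(* A test of sample size n is a [0, 1]-valued measurable function of
   (X_{1:n}, Y_{1:n}). The suprema are over subsets of [0, 1]; by the
   convention sup set0 = 0, an empty supremum is 0. *)
Definition errI n (M : set (probability TR R * probability TR R)) f0
    (psi : n.-tuple TR * n.-tuple TR -> R) : R :=
  sup [set (\int[(iid PQ.1 n \x iid PQ.2 n)%E]_z psi z)%R |
       PQ in M `&` [set PQ | tradeoff_ge (tradeoff PQ.1 PQ.2) f0]].

Definition errII n (M : set (probability TR R * probability TR R)) f1
    (psi : n.-tuple TR * n.-tuple TR -> R) : R :=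
  sup [set (\int[(iid PQ.1 n \x iid PQ.2 n)%E]_z (1 - psi z))%R |
       PQ in M `&` [set PQ | tradeoff_nge (tradeoff PQ.1 PQ.2) f1]].

Definition minimax_risk n (M : set (probability TR R * probability TR R))
    f0 f1 : R :=
  inf [set errI M f0 psi + errII M f1 psi |
       psi in [set psi : n.-tuple TR * n.-tuple TR -> R | is_test psi]].

Definition S_MLR : set (set TR) :=
  [set S | exists a : \bar R,
     S = [set x : R | (x%:E < a)%E] \/ S = [set x : R | (a < x%:E)%E]].

(* The set {q > lambda p}, which is {p = 0} for lambda = +oo. *)
Definition likelihood_set (p q : TR -> \bar R) (lambda : \bar R) : set TR :=
  if lambda == +oo%E then [set x | p x = 0%E]
  else [set x | (lambda * p x < q x)%E].

Local Open Scope charge_scope.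

Definition attainable (SS : set (set TR))
    (PQ : probability TR R * probability TR R) : Prop :=
  let mu := average PQ.1 PQ.2 in
  let p := 'd (charge_of_finite_measure PQ.1) '/d mu in
  let q := 'd (charge_of_finite_measure PQ.2) '/d mu in
  forall lambda : \bar R, (0 <= lambda)%E ->
    exists2 S, SS S &
      ae_eq mu [set: TR] (\1_S : TR -> R) \1_(likelihood_set p q lambda).

Definition attainable_pairs (SS : set (set TR)) :
  set (probability TR R * probability TR R) := [set PQ | attainable SS PQ].

Definition varfun t : R := Num.min t (Num.max (1 - t) 0).

Definition local_modulus f alpha r : R :=
  f alpha - f (alpha + r + Num.sqrt (r * varfun alpha))
  + Num.min (Num.sqrt (r * varfun (f alpha))) (f alpha).

End testing.

(* Main.v *)
Require Import Defs.
From HB Require Import structures.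
From mathcomp Require Import all_boot all_order all_algebra.
From mathcomp Require Import all_classical all_reals all_analysis.
From mathcomp Require Import measurable_realfun ring lra.

(** Le Cam's two-point method, carried out with Bernoulli laws.

    The pairs of laws supported on {0, 1} are already rich enough. Every subset
    of {0, 1} is the trace of a half-line, so each such pair is attainable for
    the half-lines ([attainable_two_point]). For a trade-off function f and x in
    [0, 1], the pair P{1} = x, Q{1} = 1 - f x has as trade-off function the
    piecewise linear interpolation of (0, 1), (x, f x) and (1, 0); by convexity
    this chord function lies above f ([tradeoff_two_point_ge]). Hence the pair
    is a null hypothesis for f0, and it touches f0 at x.

    The local modulus at a has two parts, and the larger one is at least half of
    the sum. Put r = 1 / n and let s be a small constant.
    - If the horizontal part f0 a - f0 (a + t), t = r + sqrt (r V(a)), is the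
      larger one, take x = a + s u with u <= t and, as alternative, move the
      mass P{1} from x back to a. Now a test of level a has type II error f0 x.
      This is below f1 a when the gap f0 a - f1 a is a small fraction of the
      horizontal part, because a convex function has covered at least a
      fraction s of its decrease over [a, a + t] after a fraction s of the way
      ([is_tradeoff_shrink]).
    - If the vertical part is the larger one, take x = a and lower the mass Q{0}
      from f0 a by s times that part.

    In both cases a single Bernoulli parameter p moves, by at most
    s (r + sqrt (r V(p))). Such a move costs at most 2 s r of Hellinger affinity
    ([bhattacharyya_local]); affinities multiply over the sample
    ([affinity_ge_iid]), so the squared affinity of the two samples is at least
    (1 - 2 s r) ^ (2 n) >= 1 - 4 s. An affinity rho leaves a sum of errors of at
    least 1 - eps as soon as 1 - eps ^ 2 <= rho ^ 2 ([affinity_ge_errors]), and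
    the choice s = eps ^ 2 / 4 with eps = 1 - 2 delta concludes.

    The affinity of two laws is never computed as an integral. What is
    propagated is the data-processing inequality for all tests,
    [affinity_ge]: it suffices for the error bound, and it passes to
    products by conditioning and the Cauchy-Schwarz inequality in the plane
    ([bhattacharyya_mix]). *)

Set Implicit Arguments.
Unset Strict Implicit.
Unset Printing Implicit Defensive.

Import Order.TTheory GRing.Theory Num.Theory.
Import numFieldNormedType.Exports.

Local Open Scope classical_set_scope.
Local Open Scope ring_scope.

(** * Affinity of Bernoulli laws *)

Section real.
Context (R : realType).
Implicit Types (a b p q r s x y rho : R).

(** The Hellinger affinity of the Bernoulli laws of parameters p and q. *)
Definition bhattacharyya p q := Num.sqrt (p * q) + Num.sqrt ((1 - p) * (1 - q)).

Lemma bhattacharyya_ge0 p q : 0 <= bhattacharyya p q.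
Proof. by rewrite addr_ge0// sqrtr_ge0. Qed.

Lemma bhattacharyyaC p q : bhattacharyya p q = bhattacharyya q p.
Proof. by rewrite /bhattacharyya mulrC [in X in _ + X]mulrC. Qed.

Lemma bhattacharyya_refl p : 0 <= p <= 1 -> bhattacharyya p p = 1.
Proof.
move=> /andP[p0 p1]; rewrite /bhattacharyya -!expr2 !sqrtr_sqr.
rewrite !ger0_norm ?subr_ge0//.
by rewrite addrC subrK.
Qed.

Lemma ge0_ler_sqr x y : 0 <= y -> x ^+ 2 <= y ^+ 2 -> x <= y.
Proof.
move=> y0 h; apply: (le_trans (ler_norm x)).
by rewrite -(@ler_pXn2r _ 2) ?nnegrE ?real_normK ?num_real.
Qed.

(** With p = sin^2 u and q = sin^2 v the affinity is cos (u - v) while p - q is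
    sin (u - v) sin (u + v). Algebraically, the cross term of the square is
    bounded by the inequality of arithmetic and geometric means. *)
Lemma bhattacharyya_sub p q : 0 <= p <= 1 -> 0 <= q <= 1 ->
  bhattacharyya p q ^+ 2 + (p - q) ^+ 2 <= 1.
Proof.
move=> /andP[p0 p1] /andP[q0 q1].
rewrite /bhattacharyya sqrrD !sqr_sqrtr ?mulr_ge0 ?subr_ge0//.
rewrite -sqrtrM ?mulr_ge0//.
have : Num.sqrt (p * q * ((1 - p) * (1 - q))) <=
    (p * (1 - p) + q * (1 - q)) / 2.
  have h : 0 <= (p * (1 - p) + q * (1 - q)) / 2.
    by rewrite divr_ge0// addr_ge0// mulr_ge0 ?subr_ge0.
  apply: ge0_ler_sqr => //; rewrite sqr_sqrtr ?mulr_ge0 ?subr_ge0//.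
  rewrite -subr_ge0.
  have -> : ((p * (1 - p) + q * (1 - q)) / 2) ^+ 2 -
      p * q * ((1 - p) * (1 - q)) =
    ((p * (1 - p) - q * (1 - q)) / 2) ^+ 2 by field.
  exact: sqr_ge0.
by move=> h; rewrite -mulr_natr; nra.
Qed.

Lemma cauchy_schwarz2 (a b c d : R) : 0 <= a -> 0 <= b -> 0 <= c -> 0 <= d ->
  Num.sqrt (a * c) + Num.sqrt (b * d) <= Num.sqrt ((a + b) * (c + d)).
Proof.
move=> a0 b0 c0 d0; apply: ge0_ler_sqr; first exact: sqrtr_ge0.
rewrite sqr_sqrtr ?mulr_ge0 ?addr_ge0// !sqrtrM//.
have := sqr_sqrtr a0; have := sqr_sqrtr b0.
have := sqr_sqrtr c0; have := sqr_sqrtr d0.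
move: (Num.sqrt a) (Num.sqrt b) (Num.sqrt c) (Num.sqrt d)
  => x y z t <- <- <- <-.
rewrite -subr_ge0.
have -> : (x ^+ 2 + y ^+ 2) * (z ^+ 2 + t ^+ 2) - (x * z + y * t) ^+ 2 =
    (x * t - y * z) ^+ 2.
  by ring.
exact: sqr_ge0.
Qed.

(** The induction step of tensorization: p and q are the two laws of one
    observation, a and b the conditional expectations of a test given that
    observation under the first law, a' and b' those under the second. The
    Cauchy-Schwarz inequality is applied to the test and to its complement
    separately. *)
Lemma bhattacharyya_mix p q (a a' b b' : R) rho :
  0 <= p <= 1 -> 0 <= q <= 1 ->
  0 <= a <= 1 -> 0 <= a' <= 1 -> 0 <= b <= 1 -> 0 <= b' <= 1 ->
  rho <= bhattacharyya a a' -> rho <= bhattacharyya b b' ->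
  bhattacharyya p q * rho <=
  bhattacharyya (p * a + (1 - p) * b) (q * a' + (1 - q) * b').
Proof.
move=> /andP[p0 p1] /andP[q0 q1] /andP[a0 a1] /andP[a'0 a'1].
move=> /andP[b0 b1] /andP[b'0 b'1] ha hb.
have cp : 0 <= 1 - p by rewrite subr_ge0.
have cq : 0 <= 1 - q by rewrite subr_ge0.
have ca : 0 <= 1 - a by rewrite subr_ge0.
have ca' : 0 <= 1 - a' by rewrite subr_ge0.
have cb : 0 <= 1 - b by rewrite subr_ge0.
have cb' : 0 <= 1 - b' by rewrite subr_ge0.
have -> : bhattacharyya p q * rho =
    Num.sqrt (p * q) * rho + Num.sqrt ((1 - p) * (1 - q)) * rho.
  by rewrite mulrDl.
have h1 := ler_wpM2l (sqrtr_ge0 (p * q)) ha.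
have h2 := ler_wpM2l (sqrtr_ge0 ((1 - p) * (1 - q))) hb.
apply: (le_trans (lerD h1 h2)).
rewrite /bhattacharyya (mulrDr (Num.sqrt (p * q))).
rewrite (mulrDr (Num.sqrt ((1 - p) * (1 - q)))).
rewrite -!sqrtrM ?mulr_ge0//.
have := @cauchy_schwarz2 (p * a) ((1 - p) * b) (q * a') ((1 - q) * b').
have := @cauchy_schwarz2 (p * (1 - a)) ((1 - p) * (1 - b))
  (q * (1 - a')) ((1 - q) * (1 - b')).
rewrite !mulr_ge0// => /(_ isT isT isT isT) + /(_ isT isT isT isT).
rewrite !(mulrACA p _ q) !(mulrACA (1 - p) _ (1 - q)).
have -> : p * (1 - a) + (1 - p) * (1 - b) = 1 - (p * a + (1 - p) * b) by ring.
have -> : q * (1 - a') + (1 - q) * (1 - b') =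
    1 - (q * a' + (1 - q) * b') by ring.
by move=> k1 k2; apply: le_trans (lerD k2 k1); rewrite addrACA.
Qed.

(** The difference of the square roots is controlled in two regimes: for
    x <= r by (sqrt x - sqrt y)^2 <= |x - y|, and for x > r by
    |sqrt x - sqrt y| <= |x - y| / sqrt x. *)
Lemma sqr_sqrt_sub x y r s : 0 <= x -> 0 <= y -> 0 <= s <= 2^-1 -> 0 <= r ->
  `|x - y| <= s * (r + Num.sqrt (r * x)) ->
  (Num.sqrt x - Num.sqrt y) ^+ 2 <= 2 * s * r.
Proof.
move=> x0 y0 /andP[s0 s1] r0; rewrite sqrtrM// ler_norml.
have := sqr_sqrtr x0; have := sqr_sqrtr y0; have := sqr_sqrtr r0.
have := sqrtr_ge0 x; have := sqrtr_ge0 y; have := sqrtr_ge0 r.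
move: (Num.sqrt x) (Num.sqrt y) (Num.sqrt r) => u v w w0 v0 u0.
move=> <- <- <- /andP[h1 h2].
have [uw|uw] := lerP u w.
  have h : w * u <= w ^+ 2 by rewrite expr2 ler_wpM2l.
  have [uv|uv] := lerP u v.
    apply: (@le_trans _ _ (v ^+ 2 - u ^+ 2)); nra.
  apply: (@le_trans _ _ (u ^+ 2 - v ^+ 2)); nra.
(* Here u, w stand for sqrt x, sqrt r, and w < u: divide by u. *)
have u0' : 0 < u by exact: le_lt_trans w0 uw.
have key : `|u - v| <= 2 * s * w.
  rewrite ler_norml -(ler_pM2r u0' _ (u - v)) -(ler_pM2r u0' (u - v)).
  have h : w ^+ 2 <= w * u by rewrite expr2 ler_wpM2l// ltW.
  have [uv|uv] := lerP u v; apply/andP; split; nra.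
rewrite -real_normK ?num_real//.
have := normr_ge0 (u - v); move: `|u - v| key => z key z0.
have : z ^+ 2 <= (2 * s * w) ^+ 2 by rewrite ler_pXn2r ?nnegrE//; nra.
have : s * w ^+ 2 * s <= s * w ^+ 2 * 2^-1.
  by rewrite ler_wpM2l// mulr_ge0// sqr_ge0.
nra.
Qed.

Lemma varfun_onem p : 0 <= p <= 1 -> varfun (1 - p) = varfun p.
Proof.
move=> /andP[p0 p1].
by rewrite /varfun subKr !(max_idPl _) ?subr_ge0// minC.
Qed.

(** One minus the affinity is half the sum over both atoms of the squared
    differences of the square roots, and V(p) bounds from below the mass of
    either atom. *)
Lemma bhattacharyya_local p q r s : 0 <= p <= 1 -> 0 <= q <= 1 ->
  0 <= s <= 2^-1 -> 0 <= r ->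
  `|p - q| <= s * (r + Num.sqrt (r * varfun p)) ->
  1 - 2 * s * r <= bhattacharyya p q.
Proof.
move=> /andP[p0 p1] /andP[q0 q1] s01 r0 h.
have cp : 0 <= 1 - p by rewrite subr_ge0.
have cq : 0 <= 1 - q by rewrite subr_ge0.
have s0 : 0 <= s by case/andP: s01.
have hV u : varfun p <= u -> `|p - q| <= s * (r + Num.sqrt (r * u)).
  move=> ?; apply: (le_trans h).
  by rewrite ler_wpM2l// lerD2l ler_wsqrtr// ler_wpM2l.
have vp : varfun p <= p by rewrite /varfun ge_min lexx.
have vcp : varfun p <= 1 - p by rewrite /varfun (max_idPl _)// ge_min lexx orbT.
have H1 := sqr_sqrt_sub p0 q0 s01 r0 (hV _ vp).
have e : `|1 - p - (1 - q)| = `|p - q| by rewrite distrC; congr `|_|; ring.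
have := hV _ vcp; rewrite -e => /(sqr_sqrt_sub cp cq s01 r0) H2.
rewrite /bhattacharyya !sqrtrM//.
have := sqr_sqrtr p0; have := sqr_sqrtr q0.
have := sqr_sqrtr cp; have := sqr_sqrtr cq.
nra.
Qed.

Lemma bernoulli_inequality x (n : nat) : 0 <= x <= 1 ->
  1 - n%:R * x <= (1 - x) ^+ n.
Proof.
move=> /andP[x0 x1]; elim: n => [|n IH]; first by rewrite mul0r subr0 expr0.
rewrite exprS.
have h : 0 <= 1 - x by rewrite subr_ge0.
apply: le_trans (ler_wpM2l h IH).
rewrite -natr1; have : 0 <= n%:R * x ^+ 2 by rewrite mulr_ge0// sqr_ge0.
nra.
Qed.

Lemma bhattacharyya_local_expn p q s (n : nat) :
  (1 <= n)%N -> 0 <= p <= 1 -> 0 <= q <= 1 -> 0 <= s <= 4^-1 ->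
  `|p - q| <= s * (n%:R^-1 + Num.sqrt (n%:R^-1 * varfun p)) ->
  1 - 4 * s <= (bhattacharyya p q ^+ n) ^+ 2.
Proof.
move=> n1 p01 q01 s01 h.
have n0 : (0 : R) < n%:R by rewrite ltr0n.
have nV : n%:R^-1 <= 1 :> R by rewrite invf_le1// ler1n.
have r0 : 0 <= n%:R^-1 :> R by rewrite invr_ge0 ltW.
have s01' : 0 <= s <= 2^-1 by lra.
have hb := bhattacharyya_local p01 q01 s01' r0 h.
have x01 : 0 <= 2 * s * n%:R^-1 <= 1 by nra.
rewrite -exprM.
have -> : 1 - 4 * s = 1 - (n * 2)%:R * (2 * s * n%:R^-1).
  by rewrite natrM; field; rewrite gt_eqF.
apply: (le_trans (bernoulli_inequality (n * 2) x01)).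
by rewrite ler_pXn2r ?nnegrE ?bhattacharyya_ge0 ?muln_gt0 ?n1//; lra.
Qed.

End real.

(** * Expectations of tests and affinity of laws *)

Section tests.
Context d (T : measurableType d) (R : realType).
Implicit Types (psi : T -> R) (m : probability T R).

Lemma measurable_test psi : is_test psi -> measurable_fun setT (EFin \o psi).
Proof. by move=> [mpsi _]; exact/measurable_EFinP. Qed.

Lemma is_testC psi : is_test psi -> is_test (fun x => 1 - psi x).
Proof.
move=> [mpsi psi01]; split; first exact: measurable_funB.
by move=> x; have := psi01 x; lra.
Qed.

Lemma integral_test_bounds m psi : is_test psi ->
  (0 <= \int[m]_x (psi x)%:E <= 1)%E.
Proof.
move=> tpsi; have [_ psi01] := tpsi; apply/andP; split.
  by apply: integral_ge0 => x _; rewrite lee_fin; case/andP: (psi01 x).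
rewrite -[leRHS](@probability_setT _ _ _ m) -[m _]mul1e -integral_cst//.
apply: ge0_le_integral => //.
- by move=> x _; rewrite lee_fin; case/andP: (psi01 x).
- exact: measurable_test.
- by move=> x _; rewrite lee_fin; case/andP: (psi01 x).
Qed.

Lemma EFin_Rintegral_test m psi : is_test psi ->
  (\int[m]_x psi x)%R%:E = (\int[m]_x (psi x)%:E)%E.
Proof.
move=> tpsi; rewrite fineK//; have /andP[h0 h1] := integral_test_bounds m tpsi.
by rewrite ge0_fin_numE//; exact: le_lt_trans h1 (ltry _).
Qed.

Lemma Rintegral_test_bounds m psi : is_test psi -> 0 <= \int[m]_x psi x <= 1.
Proof.
by move=> tpsi; rewrite -!lee_fin EFin_Rintegral_test// integral_test_bounds.
Qed.

Lemma Rintegral_testC m psi : is_test psi ->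
  \int[m]_x (1 - psi x) = 1 - \int[m]_x psi x.
Proof.
move=> tpsi; have [mpsi psi01] := tpsi.
rewrite RintegralB//=.
- rewrite Rintegral_cst// mul1r; congr (_ - _).
  exact: (congr1 fine (probability_setT m)).
- exact: (@finite_measure_integrable_cst _ _ _ m).
- apply/integrableP; split; first exact: measurable_test.
  under eq_integral do rewrite /= ger0_norm ?(andP (psi01 _)).1//.
  have /andP[_ h1] := integral_test_bounds m tpsi.
  exact: le_lt_trans h1 (ltry _).
Qed.

(** A lower bound rho on the Hellinger affinity of m0 and m1, expressed by its
    consequence for tests: the Bernoulli laws induced by a randomized test have
    an affinity at least that of m0 and m1. *)
Definition affinity_ge (rho : R) (m0 m1 : probability T R) :=
  forall psi, is_test psi ->
    rho <= bhattacharyya (\int[m0]_x psi x) (\int[m1]_x psi x).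

Lemma affinity_ge_refl m : affinity_ge 1 m m.
Proof.
by move=> psi tpsi; rewrite bhattacharyya_refl// Rintegral_test_bounds.
Qed.

End tests.

Lemma is_test_comp d d' (T : measurableType d) (U : measurableType d')
    (R : realType) (f : T -> U) (psi : U -> R) :
  measurable_fun [set: T] f -> is_test psi -> is_test (psi \o f).
Proof.
move=> mf [mpsi psi01].
by split=> [|x]; [exact: measurableT_comp|exact: psi01].
Qed.

Lemma Rintegral_distribution d d' (T : measurableType d) (U : measurableType d')
    (R : realType) (m : probability T R) (X : {mfun T >-> U}) (psi : U -> R) :
  is_test psi -> \int[distribution m X]_y psi y = \int[m]_x psi (X x).
Proof.
move=> tpsi; rewrite /Rintegral ge0_integral_distribution//.
  exact: measurable_test.
by move=> y; rewrite lee_fin; case/andP: (tpsi.2 y).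
Qed.

Section product.
Context d1 d2 (T1 : measurableType d1) (T2 : measurableType d2) (R : realType).
Implicit Types (mu : probability T1 R) (nu : probability T2 R).
Implicit Types (psi : T1 * T2 -> R).

Lemma is_test_pair1 psi x : is_test psi -> is_test (fun y => psi (x, y)).
Proof.
move=> tpsi; apply: (@is_test_comp _ _ _ _ _ (pair x) psi) tpsi.
exact: measurable_pair1.
Qed.

Lemma is_test_pair2 psi y : is_test psi -> is_test (fun x => psi (x, y)).
Proof.
move=> tpsi; apply: (@is_test_comp _ _ _ _ _ (pair^~ y) psi) tpsi.
exact: measurable_pair2.
Qed.

Lemma is_test_section1 nu psi : is_test psi ->
  is_test (fun x => \int[nu]_y psi (x, y)).
Proof.
move=> tpsi; split; last by move=> x; exact/Rintegral_test_bounds/is_test_pair1.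
apply: measurableT_comp; first exact: fine_measurable.
apply: (@measurable_fun_fubini_tonelli_F _ _ _ _ _ nu (EFin \o psi)).
  exact: measurable_test.
by move=> x; rewrite lee_fin; case/andP: (tpsi.2 x).
Qed.

Lemma is_test_section2 mu psi : is_test psi ->
  is_test (fun y => \int[mu]_x psi (x, y)).
Proof.
move=> tpsi; split; last by move=> y; exact/Rintegral_test_bounds/is_test_pair2.
apply: measurableT_comp; first exact: fine_measurable.
apply: (@measurable_fun_fubini_tonelli_G _ _ _ _ _ mu (EFin \o psi)).
  exact: measurable_test.
by move=> x; rewrite lee_fin; case/andP: (tpsi.2 x).
Qed.

Lemma Rintegral_prod1 mu nu psi : is_test psi ->
  \int[(mu \x nu)%E]_z psi z = \int[mu]_x \int[nu]_y psi (x, y).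
Proof.
move=> tpsi; rewrite /Rintegral fubini_tonelli1.
- congr fine; apply: eq_integral => x _; rewrite /fubini_F.
  by rewrite EFin_Rintegral_test//; exact: is_test_pair1.
- exact: measurable_test.
- by move=> x; rewrite lee_fin; case/andP: (tpsi.2 x).
Qed.

Lemma Rintegral_prod2 mu nu psi : is_test psi ->
  \int[(mu \x nu)%E]_z psi z = \int[nu]_y \int[mu]_x psi (x, y).
Proof.
move=> tpsi; rewrite /Rintegral fubini_tonelli2.
- congr fine; apply: eq_integral => y _; rewrite /fubini_G.
  by rewrite EFin_Rintegral_test//; exact: is_test_pair2.
- exact: measurable_test.
- by move=> x; rewrite lee_fin; case/andP: (tpsi.2 x).
Qed.

(** Integrating out a factor that both laws share turns a test of the pair into
    a test of the other factor. *)
Lemma affinity_ge_prodl (rho : R) (m m' : probability T1 R) nu :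
  affinity_ge rho m m' -> affinity_ge rho (m \x nu)%E (m' \x nu)%E.
Proof.
move=> h psi tpsi; rewrite !Rintegral_prod1//.
by apply: (h (fun x => \int[nu]_y psi (x, y))); exact: is_test_section1.
Qed.

Lemma affinity_ge_prodr (rho : R) mu (m m' : probability T2 R) :
  affinity_ge rho m m' -> affinity_ge rho (mu \x m)%E (mu \x m')%E.
Proof.
move=> h psi tpsi; rewrite !Rintegral_prod2//.
by apply: (h (fun y => \int[mu]_x psi (x, y))); exact: is_test_section2.
Qed.

End product.

(** * Le Cam's two-point bound *)

Section le_cam.
Context (R : realType).
Local Notation TR := (measurableTypeR R).
Implicit Types (f : R -> R) (rho eps : R).

Lemma affinity_ge_errors d (T : measurableType d) rho eps
    (m m' : probability T R) (psi : T -> R) :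
  affinity_ge rho m m' -> 0 <= rho -> 0 <= eps -> 1 - eps ^+ 2 <= rho ^+ 2 ->
  is_test psi -> 1 - eps <= \int[m]_x psi x + \int[m']_x (1 - psi x).
Proof.
move=> h rho0 eps0 hrho tpsi; rewrite Rintegral_testC//.
have := h _ tpsi.
have := bhattacharyya_sub (Rintegral_test_bounds m tpsi)
  (Rintegral_test_bounds m' tpsi).
move: (Rintegral _ _ _) (Rintegral _ _ _) => b a h1 h2.
have h3 : rho ^+ 2 <= bhattacharyya a b ^+ 2.
  by rewrite ler_pXn2r ?nnegrE ?bhattacharyya_ge0.
have : b - a <= eps.
  apply: ge0_ler_sqr => //.
  have -> : (b - a) ^+ 2 = (a - b) ^+ 2 by ring.
  lra.
lra.
Qed.

Lemma minimax_risk_ge n (M : set (probability TR R * probability TR R)) f0 f1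
    (PQ0 PQ1 : probability TR R * probability TR R) rho eps :
  M PQ0 -> tradeoff_ge (tradeoff PQ0.1 PQ0.2) f0 ->
  M PQ1 -> tradeoff_nge (tradeoff PQ1.1 PQ1.2) f1 ->
  affinity_ge rho (iid PQ0.1 n \x iid PQ0.2 n)%E
    (iid PQ1.1 n \x iid PQ1.2 n)%E ->
  0 <= rho -> 0 <= eps -> 1 - eps ^+ 2 <= rho ^+ 2 ->
  1 - eps <= minimax_risk n M f0 f1.
Proof.
move=> M0 h0 M1 h1 hrho rho0 eps0 hre; apply: lb_le_inf.
  exists (@errI R n M f0 (cst 0) + @errII R n M f1 (cst 0)), (cst 0) => //=.
  by split => // x; rewrite lexx ler01.
move=> _ [psi tpsi <-].
apply: (le_trans (affinity_ge_errors hrho rho0 eps0 hre tpsi)); apply: lerD.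
- apply: ub_le_sup; last by exists PQ0.
  exists 1 => _ [PQ _ <-].
  by have /andP[] := Rintegral_test_bounds (iid PQ.1 n \x iid PQ.2 n)%E tpsi.
- apply: ub_le_sup; last by exists PQ1.
  exists 1 => _ [PQ _ <-].
  by have /andP[] := Rintegral_test_bounds
    (iid PQ.1 n \x iid PQ.2 n)%E (is_testC tpsi).
Qed.

End le_cam.

(** * Laws supported on {0, 1} *)

Section two_point.
Context (R : realType).
Local Notation TR := (measurableTypeR R).

Definition bool_point (b : bool) : TR := b%:R.

HB.instance Definition _ :=
  isMeasurableFun.Build _ _ bool TR bool_point (fun _ _ _ => I).

(** The Bernoulli law, on the real line: p is the mass of the point 1. *)
Definition two_point (p : R) : probability TR R :=
  distribution (bernoulli_prob p : probability bool R) bool_point.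

Implicit Types (p q x y : R) (f : R -> R).

Lemma Rintegral_two_point p (psi : TR -> R) : 0 <= p <= 1 -> is_test psi ->
  \int[two_point p]_x psi x = p * psi 1 + (1 - p) * psi 0.
Proof.
move=> p01 tpsi; rewrite Rintegral_distribution// /Rintegral.
rewrite integral_bernoulli_prob// => b.
by rewrite lee_fin; case/andP: (tpsi.2 (bool_point b)).
Qed.

Lemma Rintegral_iidS (P : probability TR R) n (psi : n.+1.-tuple TR -> R) :
  is_test psi ->
  \int[iid P n.+1]_t psi t = \int[P]_x \int[iid P n]_t psi [tuple of x :: t].
Proof.
move=> tpsi; rewrite /= Rintegral_distribution//.
rewrite (@Rintegral_prod1 _ _ _ _ _ _ _ (psi \o @tuple_cons _ TR n))//.
exact: is_test_comp.
Qed.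

(** By conditioning on the first observation, a test of n + 1 observations is a
    mixture of two tests of n observations. *)
Lemma affinity_ge_iid p q n : 0 <= p <= 1 -> 0 <= q <= 1 ->
  affinity_ge (bhattacharyya p q ^+ n)
    (iid (two_point p) n) (iid (two_point q) n).
Proof.
move=> p01 q01; elim: n => [|n IH] psi tpsi; first exact: affinity_ge_refl.
rewrite !Rintegral_iidS//.
have tcons : is_test (psi \o @tuple_cons _ TR n) by exact: is_test_comp.
have tx x : is_test (fun t : n.-tuple TR => psi [tuple of x :: t]).
  exact: (is_test_pair1 x tcons).
rewrite !Rintegral_two_point//; try exact: (is_test_section1 _ tcons).
rewrite exprS; apply: bhattacharyya_mix => //;
  by [exact: Rintegral_test_bounds|exact: IH].
Qed.

Lemma two_point_null p (A : set TR) : A `<=` ~` [set 0; 1] ->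
  two_point p A = 0%E.
Proof.
move=> A01; change (bernoulli_prob p (bool_point @^-1` A) = 0%E).
rewrite (_ : bool_point @^-1` A = set0) ?measure0//.
apply/seteqP; split=> // -[] /= /A01 /=; rewrite /bool_point.
  by case; right.
by case; left.
Qed.

(** This is why laws on {0, 1} are always attainable, whatever the version of
    their likelihood ratio off these two points. *)
Lemma S_MLR_trace (L : set TR) :
  exists2 S, S_MLR S & forall x, [set 0; 1] x -> S x <-> L x.
Proof.
have [L0|L0] := pselect (L 0); have [L1|L1] := pselect (L 1).
- exists [set x : R | (x%:E < +oo)%E]; first by exists +oo%E; left.
  by move=> x [->|->]; split=> // _ /=; exact: ltry.
- exists [set x : R | (x%:E < 1%:E)%E]; first by exists 1%:E; left.
  move=> x [->|->] /=; rewrite lte_fin; first by rewrite ltr01.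
  by rewrite ltxx; split.
- exists [set x : R | (0%:E < x%:E)%E]; first by exists 0%:E; right.
  move=> x [->|->] /=; rewrite lte_fin; last by rewrite ltr01.
  by rewrite ltxx; split.
- exists [set x : R | (x%:E < -oo)%E]; first by exists -oo%E; left.
  by move=> x [->|->]; split.
Qed.

Lemma attainable_two_point p q :
  attainable_pairs (@S_MLR R) (two_point p, two_point q).
Proof.
move=> lambda _ /=; set L := likelihood_set _ _ _.
have [S SS SL] := S_MLR_trace L; exists S => //.
exists (~` [set 0; 1]); split.
- by apply: measurableC; apply: measurableU; exact: measurable_set1.
- apply: (etrans (averageE _ _ _)).
  by rewrite (_ : _ + _ = 0)%E ?mule0// -[RHS]adde0;
    congr (_ + _)%E; exact: two_point_null.
- move=> x /= + x01; apply => _; rewrite !indicE.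
  suff -> : (x \in S) = (x \in L) by [].
  by apply/idP/idP; rewrite !inE => /SL; apply.
Qed.

Lemma tradeoff_le (P Q : probability TR R) (psi : TR -> R) alpha :
  is_test psi -> \int[P]_x psi x <= alpha ->
  tradeoff P Q alpha <= \int[Q]_x (1 - psi x).
Proof.
move=> tpsi le_alpha; apply: ge_inf; last by exists psi.
exists 0 => _ [phi [tphi _] <-].
by have /andP[] := Rintegral_test_bounds Q (is_testC tphi).
Qed.

(** The test that rejects exactly at 1 has level x and type II error y. *)
Lemma tradeoff_two_point_le x y : 0 <= x <= 1 -> 0 <= y <= 1 ->
  tradeoff (two_point x) (two_point (1 - y)) x <= y.
Proof.
move=> x01 y01.
have cy01 : 0 <= 1 - y <= 1 by lra.
have t1 : is_test (\1_[set 1] : TR -> R).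
  split; first by apply: measurable_indic; exact: measurable_set1.
  by move=> t; rewrite indicE; case: (_ \in _); rewrite ?lexx ?ler01.
have e1 : (\1_[set 1] : TR -> R) 1 = 1 by rewrite indicE mem_set.
have e0 : (\1_[set 1] : TR -> R) 0 = 0.
  by rewrite indicE memNset//=; apply/eqP; rewrite eq_sym oner_eq0.
have Px : \int[two_point x]_t (\1_[set 1] : TR -> R) t <= x.
  by rewrite Rintegral_two_point// e1 e0; lra.
apply: (le_trans (tradeoff_le (two_point (1 - y)) t1 Px)).
by rewrite Rintegral_testC// Rintegral_two_point// e1 e0; lra.
Qed.

End two_point.

(** * Trade-off functions *)

Section tradeoff_functions.
Context (R : realType) (f : R -> R) (tf : is_tradeoff f).

Lemma is_tradeoff_bounds x : 0 <= x <= 1 -> 0 <= f x <= 1.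
Proof. by case: tf => h _ _ _ _ /h[-> ->]. Qed.

Lemma is_tradeoff1 : f 1 = 0.
Proof.
by case: tf => /(_ 1) h _ _ _ _; have [] := h _; [rewrite ler01 lexx|lra].
Qed.

Lemma is_tradeoff_nincr x y : 0 <= x -> x <= y -> y <= 1 -> f y <= f x.
Proof.
case: tf => _ _ _ h _ x0 xy y1.
by apply: h => //; rewrite in_itv/=; apply/andP; split=> //; lra.
Qed.

Lemma is_tradeoff_conv (t x y : R) :
  0 <= t <= 1 -> 0 <= x <= 1 -> 0 <= y <= 1 ->
  f (t * x + (1 - t) * y) <= t * f x + (1 - t) * f y.
Proof.
case: tf => _ h _ _ _ /andP[t0 t1] x01 y01.
have := h (Itv01 t0 t1) x y; rewrite !inE /= !in_itv/= => /(_ x01 y01).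
by [].
Qed.

(** Convexity, with the interval cut at 1: beyond 1 the function is 0, as it
    is at 1, so u is t or 1 - x according to whether x + t is at most 1. *)
Lemma is_tradeoff_shrink (s t x : R) : 0 <= s <= 1 -> 0 <= t -> 0 <= x <= 1 ->
  exists u, [/\ 0 <= u, u <= t, x + s * u <= 1 &
    f (x + s * u) <= f x - s * (f x - f (x + t))].
Proof.
move=> s01 t0 x01.
have fin u : 0 <= u -> x + u <= 1 -> f (x + u) = f (x + t) ->
    x + s * u <= 1 /\ f (x + s * u) <= f x - s * (f x - f (x + t)).
  move=> u0 xu1 e; have xu01 : 0 <= x + u <= 1 by lra.
  have := is_tradeoff_conv s01 xu01 x01; rewrite e.
  have -> : s * (x + u) + (1 - s) * x = x + s * u by ring.
  by move=> h; split; nra.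
have [xt|xt] := lerP (x + t) 1.
  by exists t; have [] := fin t t0 xt erefl; split.
have u0 : 0 <= 1 - x by lra.
have xu : x + (1 - x) = 1 by ring.
exists (1 - x); have [|||h1 h2] := fin (1 - x) => //; first by rewrite xu.
  by rewrite xu is_tradeoff1//; case: tf => _ _ _ _ ->.
by split=> //; lra.
Qed.

(** Write a and b for the values of a test at 1 and 0. If b < a, its level is
    the convex combination of 1, x and 0 with weights b, a - b and 1 - a, and
    convexity of f bounds f at this level by the type II error. If a <= b, the
    test does no better than a guess, whose type II error 1 - level dominates
    f. *)
Lemma tradeoff_two_point_ge x : 0 <= x <= 1 ->
  tradeoff_ge (tradeoff (two_point x) (two_point (1 - f x))) f.
Proof.
move=> x01 beta beta01.
have y01 := is_tradeoff_bounds x01.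
have cy01 : 0 <= 1 - f x <= 1 by lra.
have hf t : 0 <= t <= 1 -> f t <= 1 - t by case: tf => h _ _ _ _ /h[].
have hx := hf _ x01.
apply: lb_le_inf.
  exists (\int[two_point (1 - f x)]_z (1 - cst 0 z)), (cst 0) => //=; split.
    by split => // z; rewrite lexx ler01.
  by rewrite Rintegral_cst// mul0r; case/andP: beta01.
move=> _ [phi [tphi +] <-]; rewrite Rintegral_testC// !Rintegral_two_point//.
have := tphi.2 0; have := tphi.2 1; move: (phi 0) (phi 1) => b a a01 b01.
set beta' := x * a + _ => hbeta.
have beta'01 : 0 <= beta' <= 1 by rewrite /beta'; nra.
apply: (@le_trans _ _ (f beta')).
  by apply: is_tradeoff_nincr => //; lra.
have [ab|ba] := lerP a b.
  by apply: (le_trans (hf _ beta'01)); rewrite /beta'; nra.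
have a0 : 0 < a by lra.
(* The convex combination is taken in two steps, first of 1 and x with weight
   b / a, then of the result and 0 with weight a. *)
have ca : 0 <= b / a <= 1.
  by rewrite ler_pdivlMr// mul0r ler_pdivrMr// mul1r; lra.
have u01 : 0 <= b / a * 1 + (1 - b / a) * x <= 1 by nra.
have zero01 : 0 <= (0 : R) <= 1 by rewrite lexx ler01.
have one01 : 0 <= (1 : R) <= 1 by rewrite lexx ler01.
have -> : beta' = a * (b / a * 1 + (1 - b / a) * x) + (1 - a) * 0.
  by rewrite /beta'; field; rewrite gt_eqF.
apply: (le_trans (is_tradeoff_conv a01 u01 zero01)).
have := is_tradeoff_conv ca one01 x01; rewrite is_tradeoff1 mulr0 add0r.
move=> /(ler_wpM2l (ltW a0)).
have -> : a * ((1 - b / a) * f x) = (a - b) * f x by field; rewrite gt_eqF.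
have /andP[_] := is_tradeoff_bounds zero01.
nra.
Qed.

End tradeoff_functions.
Theorem theorem5p1 (R : realType) (delta : R) (hdelta : 0 < delta < 2^-1) :
  exists2 C : R, 0 < C &
    forall (n : nat) (f0 f1 : R -> R),
      (1 <= n)%N -> is_tradeoff f0 -> is_tradeoff f1 -> tradeoff_ge f0 f1 ->
      (exists2 alpha : R, 0 <= alpha <= 1 &
         f0 alpha - f1 alpha < C * local_modulus f0 alpha n%:R^-1) ->
      2 * delta <= minimax_risk n (attainable_pairs (@S_MLR R)) f0 f1.
Proof.
pose eps := 1 - 2 * delta; pose s := eps ^+ 2 / 4.
have eps01 : 0 < eps <= 1 by rewrite /eps; lra.
have s01 : 0 < s <= 4^-1 by rewrite /s; nra.
have s4 : 1 - eps ^+ 2 = 1 - 4 * s by rewrite /s; field.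
have s01' : 0 <= s <= 4^-1 by lra.
have s1 : 0 <= s <= 1 by lra.
(* The factor 1 / 2 pays for keeping only the larger part of the modulus. *)
exists (s / 2); first by lra.
move=> n f0 f1 n1 tf0 tf1 _ [a a01].
have -> : 2 * delta = 1 - eps by rewrite /eps; ring.
have r0 : 0 <= n%:R^-1 :> R by rewrite invr_ge0.
pose t := n%:R^-1 + Num.sqrt (n%:R^-1 * varfun a).
pose w := Num.sqrt (n%:R^-1 * varfun (f0 a)).
pose DA := f0 a - f0 (a + t); pose DB := Num.min w (f0 a).
rewrite (_ : local_modulus _ _ _ = DA + DB); last by rewrite /DA /t addrA.
move=> gap.
have t0 : 0 <= t by rewrite addr_ge0// sqrtr_ge0.
have w0 : 0 <= w by exact: sqrtr_ge0.
have y01 := is_tradeoff_bounds tf0 a01.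
have DB0 : 0 <= DB by rewrite /DB le_min w0; case/andP: y01.
have [BA|AB] := lerP DB DA.
(* The mass P{1} moves between x and a. *)
- have [u [u0 ut xu1 fxu]] := is_tradeoff_shrink tf0 s1 t0 a01.
  set x := a + s * u in xu1 fxu.
  have su0 : 0 <= s * u by rewrite mulr_ge0//; lra.
  have x01 : 0 <= x <= 1 by rewrite xu1 andbT addr_ge0//; lra.
  have fx01 := is_tradeoff_bounds tf0 x01.
  apply: (@minimax_risk_ge _ _ _ _ _ (two_point x, two_point (1 - f0 x))
    (two_point a, two_point (1 - f0 x)) (bhattacharyya x a ^+ n)) => //=.
  + exact: attainable_two_point.
  + exact: tradeoff_two_point_ge.
  + exact: attainable_two_point.
  + exists a => //; apply: (le_lt_trans (tradeoff_two_point_le a01 fx01)).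
    rewrite -/DA in fxu; nra.
  + by apply: affinity_ge_prodl; exact: affinity_ge_iid.
  + by rewrite exprn_ge0// bhattacharyya_ge0.
  + lra.
  + rewrite s4 bhattacharyyaC; apply: bhattacharyya_local_expn => //.
    rewrite -/t (_ : a - x = - (s * u)); last by rewrite /x; ring.
    by rewrite normrN ger0_norm//; apply: ler_wpM2l => //; lra.
(* The mass Q{1} moves from 1 - f0 a to 1 - y. *)
- pose y := f0 a - s * DB.
  have DBy : DB <= f0 a by rewrite /DB ge_min lexx orbT.
  have DBw : DB <= w by rewrite /DB ge_min lexx.
  have y'01 : 0 <= y <= 1 by rewrite /y; nra.
  have cf01 : 0 <= 1 - f0 a <= 1 by lra.
  have cy01 : 0 <= 1 - y <= 1 by lra.
  apply: (@minimax_risk_ge _ _ _ _ _ (two_point a, two_point (1 - f0 a))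
    (two_point a, two_point (1 - y))
    (bhattacharyya (1 - f0 a) (1 - y) ^+ n)) => //=.
  + exact: attainable_two_point.
  + exact: tradeoff_two_point_ge.
  + exact: attainable_two_point.
  + exists a => //; apply: (le_lt_trans (tradeoff_two_point_le a01 y'01)).
    rewrite /y; nra.
  + by apply: affinity_ge_prodr; exact: affinity_ge_iid.
  + by rewrite exprn_ge0// bhattacharyya_ge0.
  + lra.
  + rewrite s4; apply: bhattacharyya_local_expn => //.
    rewrite varfun_onem// -/w (_ : 1 - f0 a - _ = - (s * DB)); last first.
      by rewrite /y; ring.
    by rewrite normrN ger0_norm; nra.
Qed.
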